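(* Let $H$, $G$ be two groups and $\beta: G\times H\to G$ a right action of the group $H$ on the set $G$. There exists a bijection between the set of objects of the skeleton of the category $B_2^{\beta}(H,G)$ (equivalently, the set of isomorphism classes of objects of $B_2^{\beta}(H,G)$) and the quotient set $MP_{\beta}(H,G)/\!\approx_2$.
   Context: A matched pair of groups $(H,G,\alpha,\beta)$ consists of groups $H$, $G$, a left action $\alpha:G\times H\to H$, $\alpha(g,h)=g\rhd h$, of the group $G$ on the set $H$, and a right action $\beta:G\times H\to G$, $\beta(g,h)=g\lhd h$, of the group $H$ on the set $G$, such that for all $g,g_1,g_2\in G$, $h,h_1,h_2\in H$: $g\rhd(h_1h_2)=(g\rhd h_1)\bigl((g\lhd h_1)\rhd h_2\bigr)$ and $(g_1g_2)\lhd h=\bigl(g_1\lhd(g_2\rhd h)\bigr)(g_2\lhd h)$. The bicrossed product $H\,{}_{\alpha}\!\bowtie_{\beta} G$ is the group on the set $H\times G$ with unit $(1_H,1_G)$ and multiplication $(h_1,g_1)(h_2,g_2)=\bigl(h_1(g_1\rhd h_2),\,(g_1\lhd h_2)g_2\bigr)$. Put $i_H(h)=(h,1)$ and $\pi_G(h,g)=g$ (a map of sets). For the fixed right action $\beta$, $MP_{\beta}(H,G)$ is the set (possibly empty) of all $\alpha$ such that $(H,G,\alpha,\beta)$ is a matched pair, and $\mathrm{Ker}(\widetilde\beta)=\{h\in H\mid g\lhd h=g\ \forall g\in G\}$. $B_2^{\beta}(H,G)$ is the category with set of objects $MP_\beta(H,G)$, in which a morphism $\alpha'\to\alpha$ is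 a group morphism $\psi:H\,{}_{\alpha'}\!\bowtie_{\beta}G\to H\,{}_{\alpha}\!\bowtie_{\beta}G$ with $\psi\circ i_H=i_H$ and $\pi_G\circ\psi=\pi_G$. Two elements $\alpha',\alpha\in MP_\beta(H,G)$ (written $\rhd'$, $\rhd$) satisfy $\alpha'\approx_2\alpha$ if there exists a map $r:G\to\mathrm{Ker}(\widetilde\beta)$ such that for all $g,g_1,g_2\in G$, $h\in H$: $(g\rhd'h)\,r(g\lhd h)=r(g)(g\rhd h)$ and $r(g_1g_2)=r(g_1)\bigl(g_1\rhd r(g_2)\bigr)$. This is an equivalence relation on $MP_\beta(H,G)$. *)

(* Defs.v *)
From HB Require Import structures.
From mathcomp Require Import all_boot generic_quotient.
From mathcomp Require Import boolp.
From Stdlib Require Import RelationClasses.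

Set Implicit Arguments.
Unset Strict Implicit.
Unset Printing Implicit Defensive.

Import Algebra.
Local Open Scope quotient_scope.
Local Open Scope group_scope.

(* {eq_quot _} needs a choiceType and a boolean relation; {classic T} and
   `[< _ >] provide both for an arbitrary type and a Prop-valued relation. *)
Definition classic_rel (T : Type) (R : T -> T -> Prop) : rel {classic T} :=
  fun x y => `[< R x y >].

Lemma classic_rel_equiv (T : Type) (R : T -> T -> Prop) :
  Equivalence R -> equiv_class_of (classic_rel R).
Proof.
case=> er es et; split=> [x|x y|y x z].
- by apply/asboolP; apply: er.
- by apply/asboolP/asboolP => h; apply: es.
- by move=> /asboolP exy /asboolP eyz; apply/asboolP; apply: et exy eyz.
Qed.

Definition quotient_set (T : Type) (R : T -> T -> Prop)
    (eqR : Equivalence R) : Type :=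
  {eq_quot EquivRelPack (classic_rel_equiv eqR)}.

Record category := Category {
  ob : Type;
  hom : ob -> ob -> Type;
  idm : forall x, hom x x;
  comp_hom : forall x y z, hom y z -> hom x y -> hom x z;
  comp_idl : forall x y (f : hom x y), comp_hom (idm y) f = f;
  comp_idr : forall x y (f : hom x y), comp_hom f (idm x) = f;
  compA : forall x y z t (f : hom z t) (g : hom y z) (h : hom x y),
    comp_hom f (comp_hom g h) = comp_hom (comp_hom f g) h }.

Definition isomorphic (C : category) (x y : ob C) : Prop :=
  exists (f : hom x y) (g : hom y x),
    comp_hom g f = idm x /\ comp_hom f g = idm y.

Lemma isomorphic_equivalence (C : category) : Equivalence (@isomorphic C).
Proof.
split=> [x|x y [f [g [gf fg]]]|x y z [f [g [gf fg]]] [h [k [kh hk]]]].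
- by exists (idm x), (idm x); rewrite comp_idl.
- by exists g, f.
- exists (comp_hom h f), (comp_hom g k); split.
    by rewrite -compA (compA k) kh comp_idl.
  by rewrite -compA (compA f) fg comp_idl.
Qed.

(* The objects of a skeleton of C, up to bijection. *)
Definition iso_classes (C : category) : Type :=
  quotient_set (isomorphic_equivalence C).

(* Maps are written with the G argument first: alpha g h is g |> h and
   beta g h is g <| h. *)
Definition left_action (G : groupType) (X : Type) (a : G -> X -> X) : Prop :=
  (forall x, a 1 x = x) /\
  (forall g1 g2 x, a (g1 * g2) x = a g1 (a g2 x)).

Definition right_action (X : Type) (H : groupType) (b : X -> H -> X) : Prop :=
  (forall x, b x 1 = x) /\
  (forall x h1 h2, b x (h1 * h2) = b (b x h1) h2).

Record matched_pair (H G : groupType) (alpha : G -> H -> H)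
    (beta : G -> H -> G) : Prop := MatchedPair {
  mp_left : left_action alpha;
  mp_right : right_action beta;
  mp_mulH : forall g h1 h2,
    alpha g (h1 * h2) = alpha g h1 * alpha (beta g h1) h2;
  mp_mulG : forall g1 g2 h,
    beta (g1 * g2) h = beta g1 (alpha g2 h) * beta g2 h }.

Record MP (H G : groupType) (beta : G -> H -> G) := MkMP {
  mp_act :> G -> H -> H;
  mp_act_matched : matched_pair mp_act beta }.

Definition bicrossed (H G : groupType) (beta : G -> H -> G)
  (alpha : MP beta) : Type := (H * G)%type.

HB.instance Definition _ (H G : groupType) (beta : G -> H -> G)
  (alpha : MP beta) := Choice.copy (bicrossed alpha) (H * G)%type.

Section BicrossedGroup.
Variables (H G : groupType) (beta : G -> H -> G) (alpha : MP beta).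
Implicit Types x y z : bicrossed alpha.

Definition bicrossed_mul x y : bicrossed alpha :=
  (x.1 * alpha x.2 y.1, beta x.2 y.1 * y.2).

Definition bicrossed_one : bicrossed alpha := (1, 1).

Definition bicrossed_inv x : bicrossed alpha :=
  (alpha x.2^-1 x.1^-1, beta x.2^-1 x.1^-1).

Let mpP := mp_act_matched alpha.

Lemma mp_act1 (g : G) : alpha g 1 = 1.
Proof.
have := mp_mulH mpP g 1 1; rewrite mulg1 (proj1 (mp_right mpP)).
by move/(congr1 (mul (alpha g 1)^-1)); rewrite mulVg mulgA mulVg mul1g.
Qed.

Lemma mp_beta1 (h : H) : beta 1 h = 1.
Proof.
have := mp_mulG mpP 1 1 h; rewrite mulg1 (proj1 (mp_left mpP)).
by move/(congr1 (mul (beta 1 h)^-1)); rewrite mulVg mulgA mulVg mul1g.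
Qed.

Lemma bicrossed_mulA : associative bicrossed_mul.
Proof.
case=> [h1 g1] [h2 g2] [h3 g3]; rewrite /bicrossed_mul /=.
rewrite (mp_mulH mpP) (mp_mulG mpP) (proj2 (mp_right mpP)).
by rewrite (proj2 (mp_left mpP)) !mulgA.
Qed.

Lemma bicrossed_mul1 : left_id bicrossed_one bicrossed_mul.
Proof.
case=> [h g]; rewrite /bicrossed_mul /=.
by rewrite (proj1 (mp_left mpP)) mp_beta1 !mul1g.
Qed.

Lemma bicrossed_1mul : right_id bicrossed_one bicrossed_mul.
Proof.
case=> [h g]; rewrite /bicrossed_mul /=.
by rewrite (proj1 (mp_right mpP)) mp_act1 !mulg1.
Qed.

Lemma bicrossed_mulV : left_inverse bicrossed_one bicrossed_inv bicrossed_mul.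
Proof.
case=> [h g]; rewrite /bicrossed_mul /bicrossed_inv /=; congr (_, _).
  by rewrite -(mp_mulH mpP) mulVg mp_act1.
rewrite -(proj2 (mp_right mpP)) mulVg.
by rewrite (proj1 (mp_right mpP)) mulVg.
Qed.

Lemma bicrossed_Vmul : right_inverse bicrossed_one bicrossed_inv bicrossed_mul.
Proof.
case=> [h g]; rewrite /bicrossed_mul /bicrossed_inv /=; congr (_, _).
  by rewrite -(proj2 (mp_left mpP)) mulgV (proj1 (mp_left mpP)) mulgV.
have := mp_mulG mpP g g^-1 h^-1.
by rewrite mulgV mp_beta1.
Qed.

HB.instance Definition _ := isGroup.Build (bicrossed alpha)
  bicrossed_mulA bicrossed_mul1 bicrossed_1mul bicrossed_mulV bicrossed_Vmul.

Definition i_H (h : H) : bicrossed alpha := (h, 1).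
Definition pi_G (x : bicrossed alpha) : G := x.2.

End BicrossedGroup.

Section B2.
Variables (H G : groupType) (beta : G -> H -> G).

Record B2_hom (alpha' alpha : MP beta) := B2Hom {
  B2_mor :> {multiplicative (bicrossed alpha') -> (bicrossed alpha)};
  B2_mor_iH : B2_mor \o @i_H _ _ _ alpha' = @i_H _ _ _ alpha;
  B2_mor_piG : @pi_G _ _ _ alpha \o B2_mor = @pi_G _ _ _ alpha' }.

Lemma B2_hom_ext (alpha' alpha : MP beta) (p q : B2_hom alpha' alpha) :
  (p : bicrossed alpha' -> bicrossed alpha) = q -> p = q.
Proof.
case: p q => [[p [[pM]]] p1 p2] [[q [[qM]]] q1 q2] /= epq.
case: q / epq qM q1 q2 => qM q1 q2.
case: (pM) / (Prop_irrelevance qM pM) in p1 p2 *.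
by congr B2Hom; apply: Prop_irrelevance.
Qed.

Definition B2_id (alpha : MP beta) : B2_hom alpha alpha :=
  @B2Hom alpha alpha idfun erefl erefl.

Lemma B2_comp_iH (a b c : MP beta) (p : B2_hom b c) (q : B2_hom a b) :
  (p \o q) \o @i_H _ _ _ a = @i_H _ _ _ c.
Proof. by rewrite -(B2_mor_iH p) -(B2_mor_iH q). Qed.

Lemma B2_comp_piG (a b c : MP beta) (p : B2_hom b c) (q : B2_hom a b) :
  @pi_G _ _ _ c \o (p \o q) = @pi_G _ _ _ a.
Proof. by rewrite -(B2_mor_piG q) -(B2_mor_piG p). Qed.

Definition B2_comp (a b c : MP beta) (p : B2_hom b c) (q : B2_hom a b) :
    B2_hom a c :=
  @B2Hom a c (p \o q : {multiplicative _ -> _})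
    (B2_comp_iH p q) (B2_comp_piG p q).

Definition B2 : category.
Proof.
refine (@Category (MP beta) B2_hom B2_id B2_comp _ _ _).
- by move=> a b p; apply: B2_hom_ext.
- by move=> a b p; apply: B2_hom_ext.
- by move=> a b c d p q s; apply: B2_hom_ext.
Defined.

Definition in_Ker (h : H) : Prop := forall g, beta g h = g.

Definition approx2 (alpha' alpha : MP beta) : Prop :=
  exists r : G -> H,
    [/\ forall g, in_Ker (r g),
        forall g h, alpha' g h * r (beta g h) = r g * alpha g h
      & forall g1 g2, r (g1 * g2) = r g1 * alpha g1 (r g2)].

Lemma in_KerV (alpha : MP beta) (h : H) : in_Ker h -> in_Ker h^-1.
Proof.
have [_ bM] := mp_right (mp_act_matched alpha).
have [b1 _] := mp_right (mp_act_matched alpha).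
by move=> kh g; rewrite -[in LHS](kh g) -bM mulgV b1.
Qed.

Lemma mp_actM_Ker (alpha : MP beta) g (h1 h2 : H) :
  in_Ker h1 -> alpha g (h1 * h2) = alpha g h1 * alpha g h2.
Proof. by move=> k1; rewrite (mp_mulH (mp_act_matched alpha)) k1. Qed.

Lemma mp_actV_Ker (alpha : MP beta) g (h : H) :
  in_Ker h -> alpha g h^-1 = (alpha g h)^-1.
Proof.
move=> kh; apply: (mulgI (alpha g h)).
by rewrite -mp_actM_Ker // !mulgV mp_act1.
Qed.

Lemma approx2_equivalence : Equivalence approx2.
Proof.
split=> [a|a' a [r [kr rE rM]]|a'' a' a [s [ks sE sM]] [r [kr rE rM]]].
- exists (fun=> 1); split=> [g g'|g h|g1 g2].
  + exact: (proj1 (mp_right (mp_act_matched a))).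
  + by rewrite mulg1 mul1g.
  + by rewrite mp_act1 mulg1.
- exists (fun g => (r g)^-1); split=> [g|g h|g1 g2].
  + exact: (in_KerV a).
  + apply: (mulgI (r g)); rewrite mulgA -rE.
    by rewrite -mulgA mulgV mulg1 mulgA mulgV mul1g.
  + have kV := in_KerV a (kr g2).
    have := rE g1 (r g2)^-1; rewrite kV (mp_actV_Ker a _ (kr g2)) => e.
    rewrite rM invgM; apply: (mulIg (r g1)); apply: (mulgI (r g1)).
    by rewrite !mulgA mulgV mul1g e -!mulgA mulVg mulg1.
- exists (fun g => s g * r g); split=> [g g'|g h|g1 g2].
  + by rewrite (proj2 (mp_right (mp_act_matched a))) ks kr.
  + by rewrite mulgA sE -mulgA rE mulgA.
  + have := rE g1 (s g2); rewrite ks => e.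
    by rewrite sM rM mp_actM_Ker // -!mulgA (mulgA (a' _ _)) e -!mulgA.
Qed.

End B2.

(* Main.v *)
Require Import Defs.
From HB Require Import structures.
From mathcomp Require Import all_boot.
From mathcomp Require Import boolp.
From Stdlib Require Import RelationClasses.

(** Both quotients are taken of the same set, the set of all actions [alpha]
    matching [beta], so it is enough to see that the two equivalence relations
    coincide.

    A morphism [psi] of [B2 beta] is multiplicative and
    [(h, g) = (h, 1) * (1, g)], so it is determined by the elements
    [psi (1, g)].  Their second component is [g]; writing [r g] for the first
    one gives [psi (h, g) = (h * r g, g)] ([B2_morE]).  Conversely, this formula
    defines a morphism exactly when [r] satisfies the conditions of [approx2]:
    the images of the products [(1, g) * (h, 1)] and [(1, g1) * (1, g2)] yield
    the three conditions ([B2_hom_approx2]), and these in turn suffice for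
    multiplicativity ([approx2_B2_hom]).

    Finally [(h, g) |-> (h * (r g)^-1, g)] inverts [psi], so every morphism of
    [B2 beta] is an isomorphism ([B2_hom_iso]) and two objects are isomorphic as
    soon as there is a morphism between them. *)

Set Implicit Arguments.
Unset Strict Implicit.
Unset Printing Implicit Defensive.

Import Algebra.
Local Open Scope group_scope.

(** Equivalent relations are equal by extensionality, so the quotients are even
    equal types and the bijection is the identity. *)
Lemma quotient_set_bij (T : Type) (R S : T -> T -> Prop)
    (eqR : Equivalence R) (eqS : Equivalence S) :
  (forall x y, R x y <-> S x y) ->
  exists f : quotient_set eqR -> quotient_set eqS, bijective f.
Proof.
move=> RS; have e : R = S by apply/funext => x; apply/funext => y; apply/propext.
case: S / e eqS {RS} => eqS; rewrite (Prop_irrelevance eqS eqR).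
by exists id; exists id.
Qed.

Section Morphisms.
Variables (H G : groupType) (beta : G -> H -> G).
Implicit Types alpha : MP beta.

(** In the statements below, pairs are typed in [bicrossed alpha]: a bare pair
    would be multiplied componentwise, in the direct product [H * G]. *)
Lemma bicrossed_mulE alpha (x y : bicrossed alpha) :
  x * y = (x.1 * alpha x.2 y.1, beta x.2 y.1 * y.2) :> bicrossed alpha.
Proof. by []. Qed.

Lemma bicrossed_mul_iH alpha (h1 h2 : H) (g : G) :
  @i_H _ _ _ alpha h1 * (h2, g) = (h1 * h2, g) :> bicrossed alpha.
Proof.
rewrite bicrossed_mulE /= (proj1 (mp_left (mp_act_matched alpha))).
by rewrite (mp_beta1 alpha) mul1g.
Qed.

Lemma bicrossed_mul_1l alpha (g1 : G) (h : H) (g2 : G) :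
  ((1, g1) : bicrossed alpha) * (h, g2) = (alpha g1 h, beta g1 h * g2).
Proof. by rewrite bicrossed_mulE /= mul1g. Qed.

Lemma cocycle1 alpha (r : G -> H) :
  (forall g1 g2, r (g1 * g2) = r g1 * alpha g1 (r g2)) -> r 1 = 1.
Proof.
move/(_ 1 1); rewrite mulg1 (proj1 (mp_left (mp_act_matched alpha))).
by rewrite -[in LHS](mulg1 (r 1)) => /mulgI.
Qed.

(** The map [r : G -> H] attached to a morphism: the first component of its
    restriction to [G]. *)
Definition B2_cocycle alpha' alpha (p : B2_hom alpha' alpha) (g : G) : H :=
  (p ((1, g) : bicrossed alpha')).1.

Lemma B2_morE alpha' alpha (p : B2_hom alpha' alpha) (h : H) (g : G) :
  p ((h, g) : bicrossed alpha') = (h * B2_cocycle p g, g).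
Proof.
have p1 : p ((1, g) : bicrossed alpha') = (B2_cocycle p g, g).
  have := congr1 (fun f => f ((1, g) : bicrossed alpha')) (B2_mor_piG p).
  by rewrite /B2_cocycle /pi_G /=; case: (p _) => [a b] /= ->.
have pH : p (@i_H _ _ _ alpha' h) = @i_H _ _ _ alpha h.
  by rewrite -(B2_mor_iH p).
have -> : ((h, g) : bicrossed alpha') = @i_H _ _ _ alpha' h * (1, g).
  by rewrite bicrossed_mul_iH mulg1.
by rewrite gmulfM pH p1 bicrossed_mul_iH.
Qed.

Lemma B2_hom_approx2 alpha' alpha : B2_hom alpha' alpha -> approx2 alpha' alpha.
Proof.
move=> p; pose r := B2_cocycle p; exists r.
have pM (x y : bicrossed alpha') : p (x * y) = p x * p y by apply: gmulfM.
have pE g : p ((1, g) : bicrossed alpha') = (r g, g).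
  by rewrite B2_morE mul1g.
have r12 g1 g2 : r (g1 * g2) = r g1 * alpha g1 (r g2) /\ beta g1 (r g2) = g1.
  have := pM (1, g1) (1, g2).
  rewrite !pE bicrossed_mul_1l (mp_act1 alpha').
  rewrite (proj1 (mp_right (mp_act_matched alpha'))) pE bicrossed_mulE /=.
  by case=> -> /mulIg.
split=> [g1 g2|g h|g1 g2]; [exact: (r12 _ _).2 | | exact: (r12 _ _).1].
have := pM (1, g) (h, 1).
rewrite bicrossed_mul_1l !mulg1 !B2_morE bicrossed_mulE /= mul1g -/r.
(* [r 1] appears because [p (h, 1)] is computed as [(h * r 1, 1)] *)
by rewrite (cocycle1 (fun g1 g2 => (r12 g1 g2).1)) mulg1; case.
Qed.

Lemma approx2_B2_hom alpha' alpha :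
  approx2 alpha' alpha -> exists _ : B2_hom alpha' alpha, True.
Proof.
case=> r [rK rE rM].
have aP := mp_act_matched alpha; have [b1 bM] := mp_right aP.
pose f (x : bicrossed alpha') : bicrossed alpha := (x.1 * r x.2, x.2).
have fM : {morph f : x y / x * y}.
  case=> [h1 g1] [h2 g2]; rewrite /f !bicrossed_mulE /= bM rK; congr (_, _).
  by rewrite rM (mp_mulH aP) -!mulgA (mulgA (alpha' _ _)) rE !mulgA.
pose F := HB.pack f (isMultiplicative.Build _ _ f fM)
  : {multiplicative (bicrossed alpha') -> (bicrossed alpha)}.
have F_iH : F \o @i_H _ _ _ alpha' = @i_H _ _ _ alpha.
  by apply/funext => h /=; rewrite /f /i_H /= (cocycle1 rM) mulg1.
have F_piG : @pi_G _ _ _ alpha \o F = @pi_G _ _ _ alpha' by [].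
by exists (B2Hom F_iH F_piG).
Qed.

Lemma B2_hom_iso alpha' alpha :
  B2_hom alpha' alpha -> @isomorphic (B2 beta) alpha' alpha.
Proof.
move=> p.
pose q (x : bicrossed alpha) : bicrossed alpha' :=
  (x.1 * (B2_cocycle p x.2)^-1, x.2).
have pK : cancel p q by case=> h g; rewrite B2_morE /q /= -mulgA mulgV mulg1.
have qK : cancel q p.
  by case=> h g; rewrite /q /= B2_morE -mulgA mulVg mulg1.
(* multiplicativity passes to the inverse of a bijective morphism *)
have qM : {morph q : x y / x * y}.
  by move=> x y; apply: (can_inj pK); rewrite gmulfM !qK.
pose Q := HB.pack q (isMultiplicative.Build _ _ q qM)
  : {multiplicative (bicrossed alpha) -> (bicrossed alpha')}.
have Q_iH : Q \o @i_H _ _ _ alpha = @i_H _ _ _ alpha'.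
  by rewrite -(B2_mor_iH p); apply/funext => h; exact: pK.
have Q_piG : @pi_G _ _ _ alpha' \o Q = @pi_G _ _ _ alpha by [].
exists p, (B2Hom Q_iH Q_piG); split; apply: B2_hom_ext; apply/funext => x.
  exact: pK.
exact: qK.
Qed.

Lemma isomorphic_approx2 alpha' alpha :
  @isomorphic (B2 beta) alpha' alpha <-> approx2 alpha' alpha.
Proof.
split=> [[p _]|/approx2_B2_hom [p _]]; first exact: B2_hom_approx2.
exact: B2_hom_iso.
Qed.

End Morphisms.

Theorem theorem3p9 (H G : groupType) (beta : G -> H -> G)
    (betaP : right_action beta) :
  exists f : iso_classes (B2 beta) -> quotient_set (approx2_equivalence beta),
    bijective f.
Proof. by apply: quotient_set_bij => alpha' alpha; apply: isomorphic_approx2. Qed.
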